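(* Let $A\in\mathbb{R}^{M\times N}$ with $M<N$ have nonzero columns, let $d\in\mathbb{R}^M$ and $\beta>0$, and let $\hat u\in\mathbb{R}^N$ be a (local) minimizer of $F_d(u)=\|Au-d\|_2^2+\beta\|u\|_0$. Put $\hat\sigma=\sigma(\hat u)$. The following statements are equivalent: (i) the (local) minimum that $F_d$ has at $\hat u$ is strict; (ii) $\operatorname{rank}(A_{\hat\sigma})=\#\hat\sigma$; (iii) $\hat\sigma\in\Omega_{\max}$. Moreover, if $\hat u$ is a strict (local) minimizer of $F_d$, then $$\hat u=Z_{\hat\sigma}(\hat u_{\hat\sigma})\quad\text{with}\quad \hat u_{\hat\sigma}=\left(A_{\hat\sigma}^TA_{\hat\sigma}\right)^{-1}A_{\hat\sigma}^Td,$$ and $\#\hat\sigma=\|\hat u\|_0\le M$.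
   Context: $\mathbb{I}_k=\{1,\dots,k\}$. For $u\in\mathbb{R}^N$, $\sigma(u)=\{i\in\mathbb{I}_N: u[i]\ne0\}$ is the support and $\|u\|_0=\#\sigma(u)$ its cardinality. A point $\hat u$ is a (local) minimizer of $F_d$ if there is an open neighborhood $O$ of $\hat u$ with $F_d(\hat u)=\min_{u\in O}F_d(u)$; it is strict if there is a neighborhood $O$ of $\hat u$ with $F_d(\hat u)<F_d(v)$ for all $v\in O\setminus\{\hat u\}$. For $\omega\subseteq\mathbb{I}_N$ (listed in increasing order $\omega[1]<\omega[2]<\cdots$), $A_\omega\in\mathbb{R}^{M\times\#\omega}$ is the submatrix of $A$ formed by the columns indexed by $\omega$, $A_\omega^T=(A_\omega)^T$, $u_\omega\in\mathbb{R}^{\#\omega}$ is the corresponding subvector of $u$, and $Z_\omega:\mathbb{R}^{\#\omega}\to\mathbb{R}^N$ is zero padding: $Z_\omega(w)[\omega[k]]=w[k]$ and $Z_\omega(w)[i]=0$ for $i\notin\omega$. Conventions: $A_\varnothing\in\mathbb{R}^{M\times0}$, $\operatorname{rank}(A_\varnothing)=0$, and $Z_\varnothing$ gives $0\in\mathbb{R}^N$. For $r\in\{1,\dots,M\}$, $\Omega_r=\{\omega\subset\mathbb{I}_N:\#\omega=r=\operatorname{rank}(A_\omega)\}$; $\Omega_0=\{\varnothing\}$; $\Omega_{\max}=\bigcup_{r=0}^{M}\Omega_r$. *)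

(* Defs.v *)
From HB Require Import structures.
From mathcomp Require Import all_boot all_order all_algebra.
From mathcomp Require Import boolp classical_sets reals topology normedtype.
Import Order.TTheory GRing.Theory Num.Theory.
Import numFieldNormedType.Exports.

Set Implicit Arguments.
Unset Strict Implicit.
Unset Printing Implicit Defensive.

Local Open Scope ring_scope.

Section Vectors.
Context {R : realType}.

Definition supp n (u : 'cV[R]_n) : {set 'I_n} := [set i | u i 0 != 0]%SET.

Definition norm0 n (u : 'cV[R]_n) : nat := #|supp u|.

(* The norm carried by matrices in the library is the sup norm. *)
Definition norm2 n (x : 'cV[R]_n) : R := Num.sqrt (\sum_i x i 0 ^+ 2).

(* For a set w of ordinals, [enum_val : 'I_#|w| -> 'I_n] is the increasing
   enumeration of w (see [enum_val_ltn]). *)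
Definition subcols m n (A : 'M[R]_(m, n)) (w : {set 'I_n}) : 'M[R]_(m, #|w|) :=
  mxsub id (fun k : 'I_#|w| => enum_val k) A.

Definition subvec n (u : 'cV[R]_n) (w : {set 'I_n}) : 'cV[R]_#|w| :=
  mxsub (fun k : 'I_#|w| => enum_val k) id u.

Definition zeropad n (w : {set 'I_n}) (x : 'cV[R]_#|w|) : 'cV[R]_n :=
  \col_i if [pick k : 'I_#|w| | enum_val k == i] is Some k then x k 0 else 0.

Definition Omega m n (A : 'M[R]_(m, n)) (r : nat) : {set {set 'I_n}} :=
  if r is 0%N then [set finset.set0]%SET
  else [set w : {set 'I_n} | (#|w| == r) && (\rank (subcols A w) == r)]%SET.

Definition Omega_max m n (A : 'M[R]_(m, n)) : {set {set 'I_n}} :=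
  (\bigcup_(r < m.+1) Omega A r)%SET.

Definition objective m n (A : 'M[R]_(m, n)) (d : 'cV[R]_m) (beta : R)
    (u : 'cV[R]_n) : R :=
  norm2 (A *m u - d) ^+ 2 + beta * (norm0 u)%:R.

(* The product topology on ['cV[R]_n] is the usual topology of R^n. *)
Definition local_minimizer n (F : 'cV[R]_n -> R) (u : 'cV[R]_n) : Prop :=
  exists O : set 'cV[R]_n, open_nbhs u O /\ forall v, O v -> F u <= F v.

Definition strict_local_minimizer n (F : 'cV[R]_n -> R) (u : 'cV[R]_n) : Prop :=
  exists O : set 'cV[R]_n, nbhs u O /\ forall v, O v -> v <> u -> F u < F v.

Lemma enum_val_ltn n (w : {set 'I_n}) (j k : 'I_#|w|) :
  (j < k)%N -> (enum_val j < enum_val k)%N.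
Proof.
move=> jk; have x0 := enum_val j.
have sE : sorted (relpre (@nat_of_ord n) ltn) (enum w).
  rewrite {1}/(enum _) -enumT; apply: sorted_filter.
    by move=> a b c; apply: ltn_trans.
  by rewrite -sorted_map val_enum_ord iota_ltn_sorted.
rewrite !(enum_val_nth x0).
by apply: (sorted_ltn_nth _ x0 sE) => //;
  [move=> a b c; apply: ltn_trans | rewrite inE -cardE | rewrite inE -cardE].
Qed.

Lemma zeropad_in n (w : {set 'I_n}) (x : 'cV[R]_#|w|) (k : 'I_#|w|) :
  zeropad x (enum_val k) 0 = x k 0.
Proof.
rewrite mxE; case: pickP => [j /eqP /enum_val_inj -> //|/(_ k)].
by rewrite eqxx.
Qed.

Lemma zeropad_out n (w : {set 'I_n}) (x : 'cV[R]_#|w|) (i : 'I_n) :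
  i \notin w -> zeropad x i 0 = 0.
Proof.
move=> iw; rewrite mxE; case: pickP => // k /eqP ki.
by move: iw; rewrite -ki enum_valP.
Qed.

End Vectors.

(* Main.v *)
Require Import Defs.
From mathcomp Require Import all_boot all_order all_algebra.
From mathcomp Require Import reals.
From mathcomp Require Import lra ring boolp classical_sets topology normedtype.
Import Order.TTheory GRing.Theory Num.Theory.
Import numFieldNormedType.Exports.
Set Implicit Arguments.
Unset Strict Implicit.
Unset Printing Implicit Defensive.
Local Open Scope ring_scope.

(** Along directions supported in [supp u] the penalty does not increase, so a
    local minimizer [u] minimizes the quadratic term there and satisfies the
    normal equations on its support.  Conversely every point near [u] keeps
    the support of [u]; if it has a larger support it pays at least [beta],
    which beats the continuous quadratic term, and otherwise the Pythagorean
    identity decides: the minimum is strict exactly when the columns of [A] on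
    the support are independent. *)

(** * Euclidean inner product and Gram matrices *)

Section Dot.
Context {R : realType}.

Definition dot n (x y : 'cV[R]_n) : R := \sum_i x i 0 * y i 0.

Lemma dotE n (x y : 'cV[R]_n) : dot x y = (x^T *m y) 0 0.
Proof. by rewrite mxE; apply: eq_bigr => i _; rewrite mxE. Qed.

Lemma dot_ge0 n (x : 'cV[R]_n) : 0 <= dot x x.
Proof. by apply: sumr_ge0 => i _; rewrite -expr2 sqr_ge0. Qed.

Lemma dot_eq0 n (x : 'cV[R]_n) : (dot x x == 0) = (x == 0).
Proof.
apply/idP/eqP => [|->]; last by rewrite /dot big1 // => i _; rewrite mxE mulr0.
rewrite psumr_eq0 => [/allP x0|i _]; last by rewrite -expr2 sqr_ge0.
apply/matrixP => i j; rewrite ord1 mxE; apply/eqP.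
by have := x0 i (mem_index_enum i); rewrite /= -expr2 sqrf_eq0.
Qed.

Lemma norm2_sq n (x : 'cV[R]_n) : norm2 x ^+ 2 = dot x x.
Proof.
by rewrite /norm2 sqr_sqrtr // sumr_ge0 // => i _; exact: sqr_ge0.
Qed.

Lemma dot_mull m n (A : 'M[R]_(m, n)) x y : dot (A *m x) y = dot x (A^T *m y).
Proof. by rewrite !dotE trmx_mul mulmxA. Qed.

Lemma dot_sqDZ n (t : R) (x y : 'cV[R]_n) :
  dot (x + t *: y) (x + t *: y) = dot x x + 2 * t * dot y x + t ^+ 2 * dot y y.
Proof.
rewrite /dot !mulr_sumr -!big_split; apply: eq_bigr => i _ /=.
by rewrite !mxE; ring.
Qed.

(** Hölder's inequality for the sup norm and the 1-norm, suited to neighborhoods that are sup-norm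
    balls. *)
Lemma dot_bound n (e : R) (x y : 'cV[R]_n) :
  (forall i, `|x i 0| <= e) -> `|dot x y| <= e * \sum_i `|y i 0|.
Proof.
move=> xe; apply: le_trans (ler_norm_sum _ _ _) _.
rewrite mulr_sumr; apply: ler_sum => i _.
by rewrite normrM ler_wpM2r.
Qed.

(** If [v *m (B^T *m B) = 0], then [v *m B^T *m B *m v^T], the squared norm of [B *m v^T], vanishes,
    so [v = 0] by full column rank. *)
Lemma gram_unitmx m n (B : 'M[R]_(m, n)) :
  \rank B = n -> B^T *m B \in unitmx.
Proof.
move=> rB; have fB : row_free B^T by rewrite /row_free mxrank_tr rB.
rewrite -row_free_unit -kermx_eq0; apply/rowV0P => v /sub_kermxP vG.
apply/eqP; rewrite -(mulmx_free_eq0 _ fB) -trmx_eq0 -dot_eq0.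
by rewrite dotE trmxK trmx_mul trmxK -mulmxA (mulmxA B^T) mulmxA vG mul0mx mxE.
Qed.

End Dot.

(** * Supports, zero padding and column submatrices *)

Section Support.
Context {R : realType}.

Lemma mem_supp n (u : 'cV[R]_n) i : (i \in supp u) = (u i 0 != 0).
Proof. by rewrite inE. Qed.

Lemma subvecK n (u : 'cV[R]_n) (w : {set 'I_n}) :
  supp u \subset w -> zeropad (subvec u w) = u.
Proof.
move=> uw; apply/matrixP => i j; rewrite ord1.
have [iw|iw] := boolP (i \in w).
  by rewrite -(enum_rankK_in iw iw) zeropad_in mxE.
rewrite zeropad_out //; apply/esym/eqP; rewrite -[_ == _]negbK -mem_supp.
by apply: contra iw; apply: (fintype.subsetP uw).
Qed.

Lemma supp_zeropad n (w : {set 'I_n}) (x : 'cV[R]_#|w|) :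
  supp (zeropad x) \subset w.
Proof.
apply/fintype.subsetP => i; rewrite mem_supp; apply: contraR => iw.
by rewrite zeropad_out.
Qed.

Lemma mulmx_zeropad m n (A : 'M[R]_(m, n)) (w : {set 'I_n}) x :
  A *m zeropad x = subcols A w *m x.
Proof.
apply/matrixP => i j; rewrite ord1 !mxE (bigID (mem w)) /= addrC big1.
  rewrite add0r big_enum_val; apply: eq_bigr => k _.
  by rewrite zeropad_in !mxE.
by move=> k kw; rewrite zeropad_out // mulr0.
Qed.

(** Zero padding identifies the kernel of [subcols A w] with the kernel vectors of [A] supported in
    [w]. Perturbation arguments can then stay in the full space. *)
Lemma subcols_rankP m n (A : 'M[R]_(m, n)) (w : {set 'I_n}) :
  \rank (subcols A w) = #|w| <->
  forall h : 'cV[R]_n, supp h \subset w -> A *m h = 0 -> h = 0.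
Proof.
rewrite -mxrank_tr; split=> [rA h hw Ah|inj].
  have fA : row_free (subcols A w)^T by rewrite /row_free rA.
  rewrite -(subvecK hw) mulmx_zeropad in Ah.
  move/eqP: Ah; rewrite -trmx_eq0 trmx_mul mulmx_free_eq0 // trmx_eq0.
  move/eqP => h0; rewrite -(subvecK hw) h0.
  by apply/matrixP => i j; rewrite !mxE; case: pickP => // k _; rewrite mxE.
apply/eqP; rewrite -/(row_free _) -kermx_eq0; apply/rowV0P => v /sub_kermxP.
move=> /(congr1 trmx); rewrite trmx_mul trmxK trmx0 -mulmx_zeropad => Av.
apply/trmx_inj/matrixP => k j; rewrite ord1 -zeropad_in.
by rewrite (inj _ (supp_zeropad _) Av) !mxE.
Qed.

Lemma supp_addZ n (u h : 'cV[R]_n) t :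
  supp h \subset supp u -> supp (u + t *: h) \subset supp u.
Proof.
move=> hu; apply/fintype.subsetP => i; rewrite !mem_supp; apply: contra => /eqP ui.
have : i \notin supp h.
  by apply: contraL (eqxx (0 : R)) => /(fintype.subsetP hu); rewrite mem_supp ui.
by rewrite mem_supp negbK !mxE ui => /eqP ->; rewrite mulr0 addr0.
Qed.

Lemma Omega_maxP m n (A : 'M[R]_(m, n)) (w : {set 'I_n}) :
  \rank (subcols A w) = #|w| <-> w \in Omega_max A.
Proof.
split=> [rA|/bigcupP[[r rm] _]].
  (* The rank never exceeds the number of rows, so the index lies in the range of the union. *)
  have wm : (#|w| < m.+1)%N by rewrite ltnS -rA rank_leq_row.
  apply/bigcupP; exists (Ordinal wm) => //=.
  rewrite /Omega; case E: #|w| => [|r]; first by rewrite inE -cards_eq0 E.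
  by rewrite inE rA E eqxx.
case: r rm => [|r] rm /=; rewrite inE.
  move=> /eqP ->; apply/eqP; rewrite eqn_leq rank_leq_col /=.
  by rewrite [X in (X <= _)%N]cards0.
by move=> /andP[/eqP wr /eqP rA]; rewrite rA wr.
Qed.

End Support.

(** * Local minimizers of the objective *)

Section Minimizers.
Context {R : realType} {m n : nat}.
Variables (A : 'M[R]_(m, n)) (d : 'cV[R]_m) (beta : R).
Hypothesis beta_gt0 : 0 < beta.
Implicit Types u h v : 'cV[R]_n.

Lemma objective_addZ u h t :
  objective A d beta (u + t *: h) =
  dot (A *m u - d) (A *m u - d) + 2 * t * dot (A *m h) (A *m u - d)
  + t ^+ 2 * dot (A *m h) (A *m h) + beta * (norm0 (u + t *: h))%:R.
Proof.
rewrite /objective norm2_sq -dot_sqDZ; congr (dot _ _ + _);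
  by rewrite mulmxDr -scalemxAr addrAC.
Qed.

Lemma objectiveE u : objective A d beta u =
  dot (A *m u - d) (A *m u - d) + beta * (norm0 u)%:R.
Proof. by rewrite /objective norm2_sq. Qed.

Lemma norm0_addZ_le u h t : supp h \subset supp u ->
  beta * (norm0 (u + t *: h))%:R <= beta * (norm0 u)%:R.
Proof.
move=> hu; rewrite ler_pM2l // ler_nat.
exact/subset_leq_card/supp_addZ.
Qed.

Lemma nbhs_line u h (O : set 'cV[R]_n) : nbhs u O ->
  exists2 e : R, 0 < e & forall t, `|t| < e -> O (u + t *: h).
Proof.
move=> /nbhs_ballP[e /= e0 uO].
(* The sum dominates every entry of [h]; the added 1 keeps the divisor positive when [h = 0]. *)
have S0 : 0 < 1 + \sum_i `|h i 0| by rewrite ltr_pwDl ?ltr01 ?sumr_ge0.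
exists (e / (1 + \sum_i `|h i 0|)) => [|t]; first exact: divr_gt0.
rewrite ltr_pdivlMr // => te; apply: uO; split=> // i j; rewrite ord1 /ball /=.
rewrite !mxE opprD addNKr normrN normrM; apply: le_lt_trans te.
rewrite ler_wpM2l // (bigD1 i) //= addrCA lerDl addr_ge0 //.
exact: sumr_ge0.
Qed.

(** Near 0 the linear term dominates, and it changes sign with [t] unless [b = 0]. *)
Lemma quadratic_ge0_near0 (a b e : R) : 0 < e ->
  (forall t, `|t| < e -> 0 <= 2 * t * b + t ^+ 2 * a) -> b = 0.
Proof.
move=> e0 H; apply/eqP; apply: contraT => b0.
have b_gt0 : 0 < `|b| by rewrite normr_gt0.
have be : 0 < `|b| / e by rewrite divr_gt0.
have D0 : 0 < 1 + `|a| + `|b| / e by rewrite addr_gt0 // ltr_pwDl.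
(* This [s] gives both [s * |b| < e] and [s * a < 1], so [t = - (s * b)] is admissible and yields a
   negative value. *)
have [s s0 sD] : exists2 s : R, 0 < s & s * (1 + `|a| + `|b| / e) = 1.
  by exists (1 + `|a| + `|b| / e)^-1; rewrite ?invr_gt0 // mulVf ?gt_eqF.
have sa : s * a <= s * `|a| by rewrite ler_pM2l // ler_norm.
have sa0 : 0 <= s * `|a| by rewrite mulr_ge0 // ltW.
have sb0 : 0 < s * (`|b| / e) by rewrite mulr_gt0.
rewrite !mulrDr mulr1 in sD.
have ts : `|- (s * b)| < e.
  rewrite normrN normrM (gtr0_norm s0) -[ltRHS]mul1r -ltr_pdivrMr //.
  by rewrite -mulrA; lra.
have {H} := H _ ts; have -> : 2 * - (s * b) * b + (- (s * b)) ^+ 2 * a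
  = - (s * b ^+ 2 * (2 - s * a)) by ring.
have b2 : 0 < b ^+ 2 by rewrite exprn_even_gt0.
by rewrite oppr_ge0 leNgt (mulr_gt0 (mulr_gt0 s0 b2)) //; lra.
Qed.

(** Along [h] the penalty never exceeds its value at [u], so the increment of the quadratic term
    must be nonnegative for small [t] of either sign. *)
Lemma local_minimizer_normal u h :
  local_minimizer (objective A d beta) u -> supp h \subset supp u ->
  dot (A *m h) (A *m u - d) = 0.
Proof.
move=> [O [/open_nbhs_nbhs uO Omin]] hu.
have [e e0 eO] := nbhs_line h uO.
apply: (@quadratic_ge0_near0 (dot (A *m h) (A *m h)) _ e e0) => t te.
have := Omin _ (eO t te); rewrite objective_addZ objectiveE.
have := norm0_addZ_le t hu; lra.
Qed.

(** Moving along a nonzero kernel direction inside the support would keep the quadratic term and not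
    raise the penalty, against strictness. *)
Lemma strict_local_minimizer_inj u h :
  strict_local_minimizer (objective A d beta) u -> supp h \subset supp u ->
  A *m h = 0 -> h = 0.
Proof.
move=> [O [uO Omin]] hu Ah; have [e e0 eO] := nbhs_line h uO.
have e2 : 0 < e / 2 by rewrite divr_gt0.
have te : `|e / 2| < e by rewrite gtr0_norm //; lra.
apply: contrapT => h0; have := Omin _ (eO _ te) _.
have dot0 x : dot (0 : 'cV[R]_m) x = 0.
  by rewrite /dot big1 // => i _; rewrite mxE mul0r.
rewrite objective_addZ objectiveE Ah !dot0 !mulr0 !addr0 => H.
have := norm0_addZ_le (e / 2) hu; rewrite leNgt -(ltrD2l (dot (A *m u - d) (A *m u - d))).
(* It remains to see that the test point differs from [u]. *)
rewrite H // => /eqP.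
rewrite -subr_eq0 addrAC subrr add0r scaler_eq0 gt_eqF //= => /eqP.
exact: h0.
Qed.

Lemma near_supp u : exists2 e : R, 0 < e &
  forall h, (forall i, `|h i 0| < e) -> supp u \subset supp (u + h).
Proof.
(* The smallest nonzero modulus in [u], capped at 1; the default 1 covers [u = 0]. *)
pose e := \big[Order.min/1]_(i in supp u) `|u i 0|.
exists e => [|h he].
  apply: lt_bigmin => [|i]; first exact: ltr01.
  by rewrite mem_supp normr_gt0.
apply/fintype.subsetP => i ui; rewrite mem_supp mxE; apply/eqP => uh.
have := he i; have -> : h i 0 = - u i 0 by move: uh; lra.
by rewrite normrN ltNge bigmin_le_cond.
Qed.

Lemma near_quadratic u : exists2 e : R, 0 < e &
  forall h, (forall i, `|h i 0| < e) ->
    `|2 * dot (A *m h) (A *m u - d)| < beta.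
Proof.
pose S := \sum_i `|(A^T *m (A *m u - d)) i 0|.
have S0 : 0 <= S by apply: sumr_ge0.
have S1 : 0 < 2 * (1 + S) by lra.
(* The linear term is then at most [beta * S / (1 + S)], which is below [beta]. *)
exists (beta / (2 * (1 + S))) => [|h he]; first exact: divr_gt0.
have := dot_bound (A^T *m (A *m u - d)) (fun i => ltW (he i)).
rewrite -dot_mull normrM ger0_norm // -/S => H.
rewrite -ltr_pdivlMl //; apply: le_lt_trans H _.
rewrite mulrAC ltr_pdivrMr //.
have -> : 2^-1 * beta * (2 * (1 + S)) = beta * (1 + S) by field.
by rewrite ltr_pM2l //; lra.
Qed.

Lemma inj_strict_local_minimizer u :
  (forall h, supp h \subset supp u -> dot (A *m h) (A *m u - d) = 0) ->
  (forall h, supp h \subset supp u -> A *m h = 0 -> h = 0) ->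
  strict_local_minimizer (objective A d beta) u.
Proof.
move=> normal inj.
have [e1 e1_gt0 e1P] := near_supp u; have [e2 e2_gt0 e2P] := near_quadratic u.
exists (ball u (Order.min e1 e2)); split.
  by apply: nbhsx_ballx; rewrite lt_min e1_gt0.
move=> v uv vu; set h := v - u.
have hE : v = u + 1 *: h by rewrite scale1r addrC subrK.
have he i : `|h i 0| < Order.min e1 e2.
  by have := uv.2 i 0; rewrite /ball /= !mxE distrC.
have uh : supp u \subset supp v.
  by rewrite hE scale1r; apply: e1P => i; have := he i; rewrite lt_min => /andP[].
have qh : `|2 * dot (A *m h) (A *m u - d)| < beta.
  by apply: e2P => i; have := he i; rewrite lt_min => /andP[].
rewrite objectiveE hE objective_addZ -hE expr1n mul1r mulr1.
(* With equal supports the linear term vanishes and the increment is the squared norm of [A *m h],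
   positive by injectivity. *)
have [vu_supp|uNv] := boolP (supp v \subset supp u).
  have hu : supp h \subset supp u.
    apply/fintype.subsetP => i; apply: contraLR => ui.
    have := contra (fintype.subsetP vu_supp i) ui; move: ui.
    by rewrite !mem_supp !negbK !mxE => /eqP -> /eqP ->; rewrite subrr.
  have -> : norm0 v = norm0 u.
    by apply/eqP; rewrite eqn_leq !subset_leq_card.
  rewrite normal // mulr0 addr0 ltrD2r ltrDl lt_neqAle dot_ge0 andbT eq_sym.
  rewrite dot_eq0; apply/eqP => /(inj _ hu)/eqP; rewrite subr_eq0 => /eqP.
  exact: vu.
(* The support grows strictly, so the penalty gains at least [beta], more than the linear term can
   take away. *)
have card_uv : ((norm0 u).+1 <= norm0 v)%N.
  by apply: proper_card; rewrite properE uh.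
have : beta * (norm0 u).+1%:R <= beta * (norm0 v)%:R.
  by rewrite ler_pM2l // ler_nat.
rewrite -natr1 mulrDr mulr1; move: qh; rewrite ltr_norml => /andP[q1 q2].
have := dot_ge0 (A *m h); lra.
Qed.

Lemma normal_least_squares u :
  (forall h, supp h \subset supp u -> dot (A *m h) (A *m u - d) = 0) ->
  let As := subcols A (supp u) in
  As^T *m As *m subvec u (supp u) = As^T *m d.
Proof.
move=> normal As; apply/eqP.
rewrite -subr_eq0 -mulmxA -mulmxBr -mulmx_zeropad subvecK //.
(* The residual [x] of the normal equations, zero padded, serves as its own test direction, which
   gives [dot x x = 0]. *)
set x := (X in X == 0); rewrite -dot_eq0 {2}/x -dot_mull -mulmx_zeropad.
by rewrite normal // supp_zeropad.
Qed.

End Minimizers.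

Theorem theorem3p2 (R : realType) (M N : nat) (A : 'M[R]_(M, N))
    (d : 'cV[R]_M) (beta : R) (u : 'cV[R]_N)
    (ltMN : (M < N)%N) (colA : forall j : 'I_N, col j A != 0)
    (beta_gt0 : 0 < beta)
    (u_min : local_minimizer (objective A d beta) u) :
  [/\ strict_local_minimizer (objective A d beta) u <->
        \rank (subcols A (supp u)) = #|supp u|,
      \rank (subcols A (supp u)) = #|supp u| <->
        supp u \in Omega_max A &
      strict_local_minimizer (objective A d beta) u ->
        let As := subcols A (supp u) in
        [/\ u = zeropad (subvec u (supp u)),
            As^T *m As \in unitmx,
            subvec u (supp u) = invmx (As^T *m As) *m As^T *m d,
            #|supp u| = norm0 u &
            (norm0 u <= M)%N]].
Proof.
have normal h := local_minimizer_normal beta_gt0 (h := h) u_min.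
have strict_rank : strict_local_minimizer (objective A d beta) u <->
    \rank (subcols A (supp u)) = #|supp u|.
  rewrite subcols_rankP; split; last exact: inj_strict_local_minimizer.
  by move=> u_strict h; apply: strict_local_minimizer_inj u_strict.
split=> [//||/strict_rank rA As]; first exact: Omega_maxP.
have As_unit : As^T *m As \in unitmx by apply: gram_unitmx.
split=> //; first by rewrite subvecK.
  (* The normal equations replace [As^T *m d], and the invertible Gram matrix cancels. *)
  by rewrite -mulmxA -(normal_least_squares normal) mulKmx.
by rewrite /norm0 -rA rank_leq_row.
Qed.
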